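(* Assume that a Banach space $Y$ is a uniform quotient of a Banach space $X$. If $X$ admits an equivalent norm with property $(\beta)$, then $Y$ is reflexive.
   Context: All balls are closed. A map $f:X\to Y$ between two metric spaces is called a uniform quotient mapping if there exist two nondecreasing maps $\omega,\Omega:[0,\infty)\to[0,\infty)$ such that $\omega(r)>0$ for $r>0$, $\Omega(r)\to 0$ as $r\to 0$, and for every $x\in X$ and every $r>0$, $$B(f(x),\omega(r))\subseteq f(B(x,r))\subseteq B(f(x),\Omega(r)).$$ The metric space $Y$ is called a uniform quotient of the metric space $X$ if there is a surjective uniform quotient mapping $f:X\to Y$. Banach spaces are regarded as metric spaces via their norms. For a sequence $(x_n)_{n\ge1}$ in a Banach space, $\mathrm{sep}((x_n)_{n\ge 1})=\inf\{\|x_n-x_m\|: n\neq m\}$. A Banach space $X$ (with its given norm, closed unit ball $B_X$) has property $(\beta)$ (of Rolewicz) if for any $t\in(0,a]$, where the number $1\le a\le 2$ depends on the space $X$, there exists $\delta>0$ such that for every $x\in B_X$ and every sequence $(x_n)_{n\geq 1}\subseteq B_X$ with $\mathrm{sep}((x_n)_{n\ge1})\geq t$, there exists $n\geq 1$ with $\frac{\|x-x_n\|}{2}\leq 1-\delta$. *)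

(* Defs.v *)
From HB Require Import structures.
From mathcomp Require Import all_boot all_order all_algebra.
From mathcomp Require Import all_classical all_reals all_analysis.

Set Implicit Arguments.
Unset Strict Implicit.
Unset Printing Implicit Defensive.

Import Order.TTheory GRing.Theory Num.Theory.
Import numFieldNormedType.Exports.

Local Open Scope classical_set_scope.
Local Open Scope ring_scope.

(* A function on R stands for a map [0, oo) -> [0, oo): its values at negative
   arguments are irrelevant. *)
Definition nondecreasing_nneg (R : realType) (w : R -> R) : Prop :=
  (forall r, 0 <= r -> 0 <= w r) /\
  (forall r s, 0 <= r -> r <= s -> w r <= w s).

(* The balls are written with closed_ball_, not closed_ball: the latter is the
   closure of an open ball, hence empty instead of a singleton when Omega r
   is 0. *)
Definition uniform_quotient_map (R : realType) (X Y : normedModType R)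
    (f : X -> Y) : Prop :=
  exists omega Omega : R -> R,
    [/\ nondecreasing_nneg omega,
        nondecreasing_nneg Omega,
        forall r, 0 < r -> 0 < omega r,
        Omega r @[r --> 0^'+] --> (0 : R) &
        forall (x : X) (r : R), 0 < r ->
          closed_ball_ Num.norm (f x) (omega r) `<=`
            f @` closed_ball_ Num.norm x r /\
          f @` closed_ball_ Num.norm x r `<=`
            closed_ball_ Num.norm (f x) (Omega r)].

Definition uniform_quotient (R : realType) (Y X : normedModType R) : Prop :=
  exists f : X -> Y, set_surj [set: X] [set: Y] f /\ uniform_quotient_map f.

Definition is_norm (R : realType) (X : lmodType R) (N : X -> R) : Prop :=
  [/\ forall x y, N (x + y) <= N x + N y,
      forall (a : R) x, N (a *: x) = `|a| * N x &
      forall x, N x = 0 -> x = 0].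

Definition equivalent_norm (R : realType) (X : normedModType R)
    (N : X -> R) : Prop :=
  is_norm N /\
  exists c C : R, [/\ 0 < c, 0 < C &
    forall x, c * `|x| <= N x /\ N x <= C * `|x|].

Definition sep (R : realType) (X : lmodType R) (N : X -> R)
    (x_ : nat -> X) : R :=
  inf [set r | exists n m : nat, n <> m /\ r = N (x_ n - x_ m)].

(* Property (beta) of Rolewicz of the space X normed by N. *)
Definition property_beta (R : realType) (X : lmodType R) (N : X -> R) : Prop :=
  exists a : R, [/\ 1 <= a, a <= 2 &
    forall t, 0 < t -> t <= a ->
      exists delta : R, 0 < delta /\
        forall (x : X) (x_ : nat -> X),
          N x <= 1 -> (forall n, N (x_ n) <= 1) -> t <= sep N x_ ->
          exists n, N (x - x_ n) / 2 <= 1 - delta].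

Definition topological_dual (R : realType) (E : normedModType R) :
    set (E -> R) :=
  [set f | linear f /\ continuous f].

Definition dual_norm (R : realType) (E : normedModType R) (f : E -> R) : R :=
  sup [set `|f x| | x in [set x : E | `|x| <= 1]].

(* An element of the bidual is encoded by a function on all of E -> R, of which
   only the values on the dual matter. *)
Definition bidual (R : realType) (E : normedModType R) :
    set ((E -> R) -> R) :=
  [set phi |
    (forall (a : R) f g, topological_dual f -> topological_dual g ->
       phi (fun x => a * f x + g x) = a * phi f + phi g) /\
    (exists C : R, forall f, topological_dual f ->
       `|phi f| <= C * dual_norm f)].

(* Surjectivity of the canonical map from E to its bidual. *)
Definition reflexive_space (R : realType) (E : normedModType R) : Prop :=
  forall phi, bidual phi ->
    exists y : E, forall f, topological_dual f -> phi f = f y.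

(* Main.v *)
Require Import Defs.
From HB Require Import structures.
From mathcomp Require Import all_boot all_order all_algebra.
From mathcomp Require Import all_classical all_reals all_analysis.
From mathcomp Require Import ring lra.

(** The proof is by contradiction. A nonreflexive [Y] carries, by James'
    construction, a bounded sequence [x n] and functionals [g n] of norm at most
    [1] with [g n (x k) >= theta] for [n <= k] and [g n (x k) <= theta / 2] for
    [k < n] ([nonreflexive_staircase]). Hence a sum of [s] terms of the sequence
    has norm at least [theta * s], and two such sums [z1], [z2] with the indices
    of [z1] before those of [z2] are at distance at least [theta / 2 * s].

    Let [f : X -> Y] be the quotient map. A move [f u + z] of size of order [s]
    in [Y] lifts to a move of size of order [s] in [X] ([lift_multiple]), while
    points whose images are at distance of order [s] are at distance of order at
    least [s], for [s] large ([coarse_lipschitz]). Property (beta) makes lifts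
    shorter and shorter. Suppose that sums of [s] terms, with indices as large
    as desired, can be lifted from any point to moves of length at most [l].
    Lift one such sum from [u] to [v], and then successive ones from [v] to
    [y 0], [y 1], and so on. The [y j] are separated, because their images are.
    So [v] is the centre of a fork with handle [u] and tips [y j], and property
    (beta) gives a tip with [N (u - y j) <= 2 * q * l], where [q < 1] does not
    depend on [s]. The image of the move from [u] to this tip is a sum of
    [2 * s] terms ([block_reach_double]). After [k] doublings a sum of
    [2 ^ k * K] terms lifts to a move of length at most a constant times
    [2 ^ k * q ^ k], which contradicts the lower bound of order [2 ^ k] when [k]
    is large ([coarse_quotient_reflexive]).

    The sequence [x n] comes from an element [phi] of the bidual which is not an
    evaluation. Since [Y] is complete, the evaluations form a closed set
    ([bidual_eval_closed], by the Hahn-Banach theorem), so [phi] is at positive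
    distance from them. Separation of a point from a convex set in finite
    dimension ([convex_separation]) then provides, alternately, functionals
    almost vanishing on the previous [x k] on which [phi] is large, and points
    at which the previous functionals take almost the same values as [phi]. *)

Set Implicit Arguments.
Unset Strict Implicit.
Unset Printing Implicit Defensive.

Import Order.TTheory GRing.Theory Num.Theory.
Import numFieldNormedType.Exports.

Local Open Scope classical_set_scope.
Local Open Scope ring_scope.

(** * Norming functionals *)

Definition sublinear (R : realType) (E : lmodType R) (p : E -> R) : Prop :=
  (forall x y, p (x + y) <= p x + p y) /\
  (forall s x, 0 < s -> p (s *: x) <= s * p x).

Section Sublinear.
Variables (R : realType) (E : lmodType R).
Implicit Types (p q : E -> R) (x v : E).

Lemma sublinear0 p : sublinear p -> p 0 = 0.
Proof.
move=> [_ pZ]; apply/eqP; rewrite eq_le; apply/andP; split.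
- have := pZ (2^-1) 0; rewrite scaler0 => h; lra.
- have := pZ 2 0; rewrite scaler0 => h; lra.
Qed.

Lemma sublinearZ p s x : sublinear p -> 0 <= s -> p (s *: x) = s * p x.
Proof.
move=> ps; rewrite le_eqVlt => /predU1P[<-|s0].
  by rewrite scale0r mul0r sublinear0.
have [_ pZ] := ps; apply/eqP; rewrite eq_le pZ //=.
have := pZ s^-1 (s *: x); rewrite invr_gt0 scalerA mulVf ?gt_eqF// scale1r.
by move=> /(_ s0); rewrite mulrC ler_pdivlMr// mulrC.
Qed.

Lemma sublinear_ge p x : sublinear p -> - p (- x) <= p x.
Proof.
move=> ps; have := ps.1 x (- x); rewrite subrr sublinear0// => h; lra.
Qed.

(** The largest sublinear functional below [p] which is at most [- p v] at
    [- v]: such a [q] satisfies [q x <= q (x + t *: v) + t * q (- v)]. *)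
Definition ray_inf p v x : R :=
  inf [set r | exists2 t, 0 <= t & r = p (x + t *: v) - t * p v].

Lemma ray_inf_lb p v x t : sublinear p -> 0 <= t ->
  - p (- x) <= p (x + t *: v) - t * p v.
Proof.
move=> ps t0; rewrite -(sublinearZ _ ps)//.
have := ps.1 (x + t *: v) (- x); rewrite addrAC subrr add0r => h; lra.
Qed.

Lemma ray_inf_le p v x t : sublinear p -> 0 <= t ->
  ray_inf p v x <= p (x + t *: v) - t * p v.
Proof.
move=> ps t0; apply: ge_inf; last by exists t.
by exists (- p (- x)) => _ [s s0 ->]; exact: ray_inf_lb.
Qed.

Lemma le_ray_inf p v x c :
  (forall t, 0 <= t -> c <= p (x + t *: v) - t * p v) -> c <= ray_inf p v x.
Proof.
move=> h; apply: lb_le_inf; first by exists (p (x + 0 *: v) - 0 * p v), 0.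
by move=> _ [t t0 ->]; exact: h.
Qed.

Lemma ray_inf_le_self p v x : sublinear p -> ray_inf p v x <= p x.
Proof.
move=> ps; have := ray_inf_le v x ps (lexx 0).
by rewrite scale0r addr0 mul0r subr0.
Qed.

Lemma ray_inf_sublinear p v : sublinear p -> sublinear (ray_inf p v).
Proof.
move=> ps; split=> [x y|s x s0].
- rewrite -lerBlDr; apply: le_ray_inf => t t0.
  rewrite lerBlDr -lerBlDl; apply: le_ray_inf => u u0.
  rewrite lerBlDl; apply: le_trans (ray_inf_le v (x + y) ps (addr_ge0 t0 u0)) _.
  have := ps.1 (x + t *: v) (y + u *: v).
  rewrite addrACA -scalerDl => h; lra.
- rewrite mulrC -ler_pdivrMr//; apply: le_ray_inf => t t0.
  rewrite ler_pdivrMr// mulrC.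
  have st : 0 <= s * t by rewrite mulr_ge0// ltW.
  apply: le_trans (ray_inf_le v (s *: x) ps st) _.
  rewrite -scalerA -scalerDr (sublinearZ _ ps (ltW s0)).
  by rewrite mulrBr mulrA.
Qed.

(** The pointwise infimum of a chain of sublinear functionals is sublinear, so
    that Zorn's lemma yields minimal ones. *)
Lemma sublinear_min p : sublinear p -> exists q, [/\ sublinear q,
  forall x, q x <= p x &
  forall q', sublinear q' -> (forall x, q' x <= q x) -> forall x, q x <= q' x].
Proof.
move=> ps.
pose T := {q | sublinear q /\ forall x, q x <= p x}.
pose le (s t : T) : bool := `[< forall x, sval t x <= sval s x >].
pose p_T : T := exist _ p (conj ps (fun x => lexx _)).
have [||A Atot|[q [qs qp]] qmin] := @ZL_preorder T p_T le.
- by move=> t; apply/asboolP.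
- move=> r s t /asboolP rs /asboolP st; apply/asboolP => x.
  exact: le_trans (st x) (rs x).
- have [[a0 Aa0]|A0] := pselect (A !=set0); last first.
    by exists p_T => s As; case: A0; exists s.
  pose m x := inf [set sval a x | a in A].
  have mlb a x : A a -> m x <= sval a x.
    move=> Aa; apply: ge_inf; last by exists a.
    exists (- p (- x)) => _ [b Ab <-]; have [bs bp] := svalP b.
    by apply: le_trans (sublinear_ge x bs); rewrite lerN2.
  have le_m x c : (forall a, A a -> c <= sval a x) -> c <= m x.
    move=> h; apply: lb_le_inf; first by exists (sval a0 x), a0.
    by move=> _ [a Aa <-]; exact: h.
  have ms : sublinear m.
    split=> [x y|s x s0].
    + rewrite -lerBlDr; apply: (le_m) => a Aa; rewrite lerBlDr -lerBlDl.
      apply: (le_m) => b Ab; rewrite lerBlDl.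
      have [/asboolP ab|/asboolP ba] := Atot _ _ Aa Ab.
      * apply: le_trans (mlb b _ Ab) _.
        by apply: le_trans ((svalP b).1.1 x y) _; rewrite lerD2r.
      * apply: le_trans (mlb a _ Aa) _.
        by apply: le_trans ((svalP a).1.1 x y) _; rewrite lerD2l.
    + rewrite mulrC -ler_pdivrMr//; apply: (le_m) => a Aa.
      rewrite ler_pdivrMr// mulrC -(sublinearZ _ (svalP a).1 (ltW s0)).
      exact: mlb.
  have mp x : m x <= p x by apply: le_trans (mlb a0 x Aa0) ((svalP a0).2 x).
  exists (exist _ m (conj ms mp)) => a Aa; apply/asboolP => x /=; exact: mlb.
- exists q; split => // q' q's q'q x.
  have q'p y : q' y <= p y by exact: le_trans (q'q y) (qp y).
  have /(_ _)/asboolP := qmin (exist _ q' (conj q's q'p)).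
  by apply; apply/asboolP.
Qed.

(** A minimal sublinear functional agrees with its [ray_inf] in every direction,
    which forces additivity. *)
Lemma sublinear_ge_linear p : sublinear p ->
  exists g : {linear E -> R}, forall x, g x <= p x.
Proof.
move=> /sublinear_min[q [qs qp qmin]].
have qD x v : q (x + v) = q x + q v.
  apply/eqP; rewrite eq_le qs.1/= -lerBrDr.
  apply: le_trans (qmin _ (ray_inf_sublinear v qs) _ x) _.
    by move=> y; exact: ray_inf_le_self.
  by have := ray_inf_le v x qs ler01; rewrite scale1r mul1r.
have qN x : q (- x) = - q x.
  by apply/eqP; rewrite -addr_eq0 -qD addNr sublinear0.
have qZ s x : q (s *: x) = s * q x.
  have [s0|s0] := leP 0 s; first exact: sublinearZ.
  by rewrite -[s]opprK scaleNr qN sublinearZ ?mulNr// oppr_ge0 ltW.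
have ql : linear q by move=> a x y; rewrite qD qZ.
pose a := GRing.isLinear.Build _ _ _ _ q ql.
by exists (HB.pack_for {linear E -> R} q a).
Qed.

End Sublinear.

Lemma norm_sublinear (R : realType) (E : normedModType R) :
  sublinear (fun x : E => `|x|).
Proof.
split=> [x y|s x s0]; first exact: ler_normD.
by rewrite normrZ gtr0_norm.
Qed.

(** A linear [g] below [ray_inf] of the norm in the direction [v] satisfies
    [g (- v) <= - `|v|]. *)
Lemma norming_functional (R : realType) (E : normedModType R) (v : E) :
  exists g : {linear E -> R}, (forall x, `|g x| <= `|x|) /\ g v = `|v|.
Proof.
have ns := norm_sublinear E.
have [g gp] := sublinear_ge_linear (ray_inf_sublinear v ns).
have gn x : g x <= `|x| := le_trans (gp x) (ray_inf_le_self v x ns).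
exists g; split=> [x|].
  by rewrite ler_norml gn andbT lerNl -linearN -(normrN x).
apply/eqP; rewrite eq_le gn/=.
have := le_trans (gp (- v)) (ray_inf_le v (- v) ns ler01).
by rewrite scale1r addNr normr0 mul1r sub0r linearN lerN2.
Qed.

(** * Separation in finite dimension *)

(** Let [c] in [C] almost minimize the Euclidean distance to [p]. Moving from
    [c] towards [u] cannot decrease this distance by much, so the hyperplane
    through [c] orthogonal to [p - c] almost separates [p] from [C]; the
    boundedness of [C] makes the error uniform in [u]. *)
Lemma convex_separation (R : realType) (I : finType) (C : set (I -> R))
    (p : I -> R) (K eps : R) :
  C !=set0 ->
  (forall u v t, C u -> C v -> 0 <= t -> t <= 1 ->
    C (fun i => u i + t * (v i - u i))) ->
  (forall u, C u -> forall i, `|u i| <= K) ->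
  0 < eps ->
  (exists2 u, C u & forall i, `|u i - p i| <= eps) \/
  (exists (a : I -> R) (delta : R), 0 < delta /\
    forall u, C u -> \sum_i a i * u i <= \sum_i a i * p i - delta).
Proof.
move=> [u0 Cu0] Cconv CK eps0.
have [|far] := pselect (exists2 u, C u & forall i, `|u i - p i| <= eps).
  by left.
right.
pose D u := \sum_i (u i - p i) ^+ 2.
pose B := \sum_i (K + `|p i|) ^+ 2.
have D_ge u : C u -> eps ^+ 2 <= D u.
  move=> Cu; have [i] : exists i, eps < `|u i - p i|.
    apply: contrapT => near_p; apply: far; exists u => // i.
    by rewrite leNgt; apply/negP => ?; apply: near_p; exists i.
  move=> ui; rewrite /D (bigD1 i)//= -[X in X <= _]addr0 lerD//.
    rewrite -[X in _ <= X]real_normK ?num_real//.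
    by rewrite lerXn2r// ?nnegrE ltW.
  by apply: sumr_ge0 => j _; exact: sqr_ge0.
have D_le u : C u -> D u <= B.
  move=> Cu; apply: ler_sum => i _; rewrite -[X in X <= _]real_normK ?num_real//.
  have := CK _ Cu i => uK.
  have uiK : `|u i - p i| <= K + `|p i|.
    by apply: le_trans (ler_normB _ _) _; rewrite lerD2r.
  by rewrite lerXn2r// nnegrE// (le_trans _ uiK).
pose d := inf [set D u | u in C].
have Dlb : has_lbound [set D u | u in C].
  by exists (eps ^+ 2) => _ [u Cu <-]; exact: D_ge.
have Dn0 : [set D u | u in C] !=set0 by exists (D u0), u0.
have d0 : 0 < d.
  apply: lt_le_trans (_ : eps ^+ 2 <= d); first by rewrite exprn_gt0.
  by apply: lb_le_inf => // _ [u Cu <-]; exact: D_ge.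
have dD u : C u -> d <= D u by move=> Cu; apply: ge_inf => //; exists u.
have dB : d <= B by apply: le_trans (dD _ Cu0) (D_le _ Cu0).
(* With squared distance at most [d + t ^ 2] at [c], comparing [c] with
   [c + t (u - c)] costs an error at most [t (1 + 4 B) / 2]; this [t] makes it
   [d / 2]. *)
pose t := d / (1 + 4 * B).
have t0 : 0 < t by rewrite divr_gt0//; lra.
have t1 : t <= 1 by rewrite ler_pdivrMr; lra.
have tB : t * (1 + 4 * B) = d by rewrite /t mulfVK// gt_eqF//; lra.
have [|_ [c Cc <-] cmin] := inf_adherent _ (conj Dn0 Dlb) (eps := t ^+ 2).
  by rewrite exprn_gt0.
exists (fun i => p i - c i), (d / 2); split=> [|u Cu]; first by rewrite divr_gt0.
pose X := \sum_i (c i - p i) * (u i - c i).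
pose S := \sum_i (u i - c i) ^+ 2.
have S_le : S <= 4 * B.
  have : S <= 2 * D u + 2 * D c.
    rewrite /S /D !mulr_sumr -big_split/=; apply: ler_sum => i _.
    by have := sqr_ge0 (u i - p i + (c i - p i)) => h; nra.
  have := D_le _ Cu; have := D_le _ Cc => *; lra.
have Dt : D (fun i => c i + t * (u i - c i)) = D c + 2 * t * X + t ^+ 2 * S.
  rewrite /D /X /S !mulr_sumr -!big_split/=; apply: eq_bigr => i _; ring.
have X_ge : - (d / 2) <= X.
  have := dD _ (Cconv _ _ _ Cc Cu (ltW t0) t1).
  rewrite Dt -/d in cmin * => Dmin.
  have : 0 <= t * (2 * X + t * (1 + S)) by nra.
  rewrite pmulr_rge0// => h.
  have : t * S <= t * (4 * B) by rewrite ler_pM2l.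
  lra.
have -> : \sum_i (p i - c i) * u i = \sum_i (p i - c i) * p i - D c - X.
  rewrite /D /X -!sumrB; apply: eq_bigr => i _; ring.
have := dD _ Cc => ?; lra.
Qed.

(** * The dual and the bidual *)

Section Dual.
Variables (R : realType) (E : normedModType R).
Implicit Types (f g : E -> R) (phi : (E -> R) -> R).

Lemma linear_bundle f : linear f -> exists g : {linear E -> R}, f = g.
Proof.
move=> lf; pose a := GRing.isLinear.Build _ _ _ _ f lf.
by exists (HB.pack_for {linear E -> R} f a).
Qed.

(** Linearity with the multiplication of [R], in the form suited to [ring],
    instead of the scaling of [R] over itself. *)
Lemma linear_scalarP f :
  linear f <-> forall a x y, f (a *: x + y) = a * f x + f y.
Proof. by []. Qed.

Lemma topological_dualP f : topological_dual f <->
  linear f /\ exists2 C, 0 < C & forall x, `|f x| <= C * `|x|.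
Proof.
split=> [[/linear_bundle[g ->]] /linear_bounded_continuous/linear_boundedP gb|].
  split; first exact: linearP.
  near +oo_R => C; exists C => //.
  by near: C.
move=> [/linear_bundle[g ->] [C C0 gC]]; split; first exact: linearP.
apply/linear_bounded_continuous/linear_boundedP.
near=> r => x; apply: le_trans (gC x) _.
by rewrite ler_wpM2r//; near: r; exact: nbhs_pinfty_ge.
Unshelve. all: by end_near. Qed.

Definition dual_ball : set (E -> R) :=
  [set f | linear f /\ forall x, `|f x| <= `|x|].

Lemma dual_ball_dual f : dual_ball f -> topological_dual f.
Proof.
move=> [lf f1]; apply/topological_dualP; split => //.
by exists 1 => // x; rewrite mul1r.
Qed.

Lemma dual_ball0 : dual_ball (fun=> 0).
Proof.
split=> [a x y|x]; last by rewrite normr0.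
by rewrite addr0 scaler0.
Qed.

Lemma topological_dualD (a b : R) f g :
  topological_dual f -> topological_dual g ->
  topological_dual (fun x => a * f x + b * g x).
Proof.
move=> /topological_dualP[lf [C C0 fC]] /topological_dualP[lg [D D0 gD]].
move/linear_scalarP in lf; move/linear_scalarP in lg.
apply/topological_dualP; split.
  by apply/linear_scalarP => c x y; rewrite lf lg; ring.
exists (`|a| * C + `|b| * D + 1).
  by rewrite ltr_wpDl// addr_ge0// mulr_ge0// ltW.
move=> x; apply: le_trans (ler_normD _ _) _; rewrite !normrM !mulrDl mul1r.
rewrite -[X in X <= _]addr0 lerD// lerD// -!mulrA; exact: ler_wpM2l.
Qed.

Lemma topological_dual_sum (I : Type) (s : seq I) (a : I -> R) (f : I -> E -> R) :
  (forall i, topological_dual (f i)) ->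
  topological_dual (fun x => \sum_(i <- s) a i * f i x).
Proof.
move=> df; elim: s => [|i s ih].
  by under eq_fun do rewrite big_nil; exact/dual_ball_dual/dual_ball0.
under eq_fun do rewrite big_cons -[X in _ + X]mul1r.
exact: topological_dualD.
Qed.

Lemma dual_ball_convex (t : R) f g :
  dual_ball f -> dual_ball g -> 0 <= t -> t <= 1 ->
  dual_ball (fun x => f x + t * (g x - f x)).
Proof.
move=> [/linear_scalarP lf f1] [/linear_scalarP lg g1] t0 t1.
split=> [|x].
  by apply/linear_scalarP => c x y; rewrite lf lg; ring.
have -> : f x + t * (g x - f x) = (1 - t) * f x + t * g x by ring.
apply: le_trans (ler_normD _ _) _; rewrite !normrM (ger0_norm t0).
rewrite ger0_norm ?subr_ge0//.
have := f1 x; have := g1 x => hg hf.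
have : (1 - t) * `|f x| <= (1 - t) * `|x| by rewrite ler_wpM2l// subr_ge0.
have : t * `|g x| <= t * `|x| by rewrite ler_wpM2l.
lra.
Qed.

Section Bidual.
Variable phi : (E -> R) -> R.
Hypothesis hphi : bidual phi.

Lemma bidualZ (a : R) f :
  topological_dual f -> phi (fun x => a * f x) = a * phi f.
Proof.
move=> df; have := hphi.1 (a - 1) f f df df.
under eq_fun do rewrite mulrBl mul1r subrK.
by move=> ->; rewrite mulrBl mul1r subrK.
Qed.

Lemma bidual0 : phi (fun=> 0) = 0.
Proof.
rewrite -[RHS](mul0r (phi (fun=> 0))) -bidualZ; last first.
  exact/dual_ball_dual/dual_ball0.
by congr phi; apply/funext => x; rewrite mul0r.
Qed.

Lemma bidual_sum (I : Type) (s : seq I) (a : I -> R) (f : I -> E -> R) :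
  (forall i, topological_dual (f i)) ->
  phi (fun x => \sum_(i <- s) a i * f i x) = \sum_(i <- s) a i * phi (f i).
Proof.
move=> df; elim: s => [|i s ih].
  by rewrite big_nil -[RHS]bidual0; congr phi; apply/funext => x; rewrite big_nil.
have -> : (fun x => \sum_(j <- i :: s) a j * f j x) =
          (fun x => a i * f i x + \sum_(j <- s) a j * f j x).
  by apply/funext => x; rewrite big_cons.
by rewrite hphi.1// ?ih ?big_cons//; exact: topological_dual_sum.
Qed.

(** The bound by the dual norm, restated without a supremum. *)
Lemma bidual_bounded : exists2 M, 0 < M & forall f (c : R), topological_dual f ->
  (forall x, `|x| <= 1 -> `|f x| <= c) -> `|phi f| <= M * c.
Proof.
have [C hC] := hphi.2.
exists (`|C| + 1); first by rewrite ltr_wpDl.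
move=> f c df fc; apply: le_trans (hC _ df) _.
pose S := [set `|f x| | x in [set x : E | `|x| <= 1]].
have Sf : S `|f 0| by exists 0 => //=; rewrite normr0.
have Sc : ubound S c by move=> _ [x x1 <-]; exact: fc.
have dc : dual_norm f <= c by apply: ge_sup => //; exists `|f 0|.
have d0 : 0 <= dual_norm f.
  by apply: le_trans (normr_ge0 (f 0)) _; apply: ub_le_sup => //; exists c.
apply: le_trans (_ : `|C| * dual_norm f <= _).
  by rewrite ler_wpM2r// ler_norm.
by apply: ler_pM => //; rewrite lerDl.
Qed.

End Bidual.
End Dual.
(** * Nonreflexive spaces *)

Section Nonreflexive.
Variables (R : realType) (E : normedModType R) (phi : (E -> R) -> R).
Hypothesis hphi : bidual phi.

Lemma bidual_segment (t : R) (f g : E -> R) :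
  topological_dual f -> topological_dual g ->
  phi (fun x => f x + t * (g x - f x)) = phi f + t * (phi g - phi f).
Proof.
move=> df dg; have d0 := dual_ball_dual (@dual_ball0 R E).
have -> : (fun x => f x + t * (g x - f x)) =
          (fun x => (1 - t) * f x + (t * g x)).
  by apply/funext => x; ring.
rewrite hphi.1//; last first.
  have := topological_dualD t 0 dg d0.
  by congr topological_dual; apply/funext => x; rewrite mulr0 addr0.
by rewrite bidualZ//; ring.
Qed.

Variable M : R.
Hypothesis hM : forall f c, topological_dual f ->
  (forall x, `|x| <= 1 -> `|f x| <= c) -> `|phi f| <= M * c.

(** Goldstine's theorem for finitely many functionals. If the values of [phi]
    are separated from those of the points of the ball of radius [M] by
    coefficients [a], then [phi] exceeds [M] times the norm of the functional
    [\sum_i a i * f i]. *)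
Lemma bidual_approx_eval (I : finType) (f : I -> E -> R) (eps : R) :
  0 < M -> (forall i, dual_ball (f i)) -> 0 < eps ->
  exists2 x, `|x| <= M & forall i, `|f i x - phi (f i)| <= eps.
Proof.
move=> M0 fb eps0.
pose C := [set u : I -> R | exists2 x, `|x| <= M & u = fun i => f i x].
have [||_ [x xM ->] i|//|[u [x xM ->]] xe|[a [delta [delta0 h]]]] :=
    @convex_separation R I C (fun i => phi (f i)) M eps.
- by exists (fun i => f i 0), 0 => //; rewrite normr0 ltW.
- move=> u v t [x xM ->] [y yM ->] t0 t1.
  exists (x + t *: (y - x)).
    have -> : x + t *: (y - x) = (1 - t) *: x + t *: y.
      by rewrite scalerBr scalerBl scale1r addrA addrAC.
    apply: le_trans (ler_normD _ _) _; rewrite !normrZ (ger0_norm t0).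
    rewrite ger0_norm ?subr_ge0//.
    have : (1 - t) * `|x| <= (1 - t) * M by rewrite ler_wpM2l// subr_ge0.
    have : t * `|y| <= t * M by rewrite ler_wpM2l.
    by move=> *; lra.
  apply/funext => i; have [/linear_bundle[g ->] _] := fb i.
  by rewrite linearD linearZ linearB.
- exact: le_trans ((fb i).2 x) xM.
- by exists x.
- exfalso; pose h0 x := \sum_i a i * f i x.
  have df i := dual_ball_dual (fb i).
  have dh : topological_dual h0 by exact: topological_dual_sum.
  have ph : phi h0 = \sum_i a i * phi (f i) by exact: bidual_sum.
  have hle x : `|x| <= M -> h0 x <= phi h0 - delta.
    by move=> xM; rewrite ph; apply: (h (fun i => f i x)); exists x.
  have [lh _] := dh; have [k hk] := linear_bundle lh.
  have : `|phi h0| <= M * ((phi h0 - delta) / M).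
    apply: hM => // x x1; rewrite ler_pdivlMr//.
    have MxM : `|M *: x| <= M.
      by rewrite normrZ gtr0_norm// -[leRHS]mulr1 ler_pM2l.
    have := hle (M *: x) MxM; have := hle (- (M *: x)); rewrite normrN.
    move=> /(_ MxM); rewrite hk linearN linearZ/= => h1 h2.
    rewrite mulrC -[X in X * _]gtr0_norm// -normrM ler_norml h2 andbT.
    by rewrite lerNl.
  rewrite mulrC divfK ?gt_eqF//; have := ler_norm (phi h0) => *; lra.
Qed.

(** The vectors [(phi g, g (x 0), ..., g (x (n - 1)))] for [g] in the dual ball
    come arbitrarily close to [(d, 0, ..., 0)]. Otherwise a functional with
    coefficients [b] and [a j] separates them; then [b > 0], and [phi] is at
    distance less than [d] from the evaluation at [- b^-1 \sum_j a j * x j]. *)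
Lemma dual_approx_annihilator (d : R) (n : nat) (x : 'I_n -> E) (eps : R) :
  (forall z, exists2 g, dual_ball g & d < `|phi g - g z|) ->
  0 < d -> 0 < eps ->
  exists g, [/\ dual_ball g, `|phi g - d| <= eps &
    forall i, `|g (x i)| <= eps].
Proof.
move=> far d0 eps0.
pose coord (g : E -> R) (i : 'I_n.+1) :=
  if unlift ord0 i is Some j then g (x j) else phi g.
pose p (i : 'I_n.+1) := if unlift ord0 i is Some j then 0 else d.
pose C := [set u | exists2 g, dual_ball g & u = coord g].
have M0 g : dual_ball g -> `|phi g| <= M.
  move=> bg; have := @hM g 1 (dual_ball_dual bg).
  by rewrite mulr1; apply => y y1; apply: le_trans (bg.2 y) y1.
(* The coordinate [ord0] is the one of [phi]. *)
have [||_ [g bg ->] i|//|[u [g bg ->]] ge|[a [delta [delta0 h]]]] :=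
    @convex_separation R 'I_n.+1 C p (M + \sum_i `|x i|) eps.
- by exists (coord (fun=> 0)), (fun=> 0) => //; exact: dual_ball0.
- move=> u v t [f bf ->] [g bg ->] t0 t1.
  exists (fun x => f x + t * (g x - f x)); first exact: dual_ball_convex.
  apply/funext => i; rewrite /coord; case: (unlift _ _) => //.
  by rewrite bidual_segment//; exact: dual_ball_dual.
- have xs0 : 0 <= \sum_i `|x i| by rewrite sumr_ge0.
  rewrite /coord; case: (unlift _ _) => [j|].
    apply: le_trans (bg.2 _) _; rewrite (bigD1 j)//= addrCA lerDl addr_ge0//.
      exact: le_trans (normr_ge0 _) (M0 _ bg).
    by rewrite sumr_ge0.
  by apply: le_trans (M0 _ bg) _; rewrite lerDl.
- exists g; split=> // [|i].
    by have := ge ord0; rewrite /coord /p unlift_none.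
  by have := ge (lift ord0 i); rewrite /coord /p liftK subr0.
- exfalso; pose b := a ord0; pose w := \sum_(i < n) a (lift ord0 i) *: x i.
  have ph : \sum_i a i * p i = b * d.
    rewrite big_ord_recl big1 ?addr0 ?/p ?unlift_none// => i _.
    by rewrite liftK mulr0.
  have cg g : dual_ball g -> b * phi g + g w <= b * d - delta.
    move=> bg; rewrite -ph; apply: le_trans (h (coord g) _); last by exists g.
    rewrite big_ord_recl /coord unlift_none lerD2l.
    have [/linear_bundle[k ->] _] := bg.
    rewrite linear_sum; apply: ler_sum => i _.
    by rewrite liftK linearZ.
  have b0 : 0 < b.
    have := cg _ (@dual_ball0 R E); rewrite bidual0// mulr0 addr0 => h0.
    by rewrite -(pmulr_lgt0 _ d0); lra.
  have lt_d g : dual_ball g -> phi g - g (- b^-1 *: w) < d.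
    move=> bg; rewrite -(ltr_pM2l b0).
    apply: le_lt_trans (_ : b * d - delta < _); last by lra.
    apply: le_trans (cg g bg); rewrite mulrBr lerD2l.
    have [/linear_bundle[k ->] _] := bg.
    have -> : k (- b^-1 *: w) = - b^-1 * k w by exact: linearZ.
    by rewrite mulNr mulrN opprK mulVKf ?gt_eqF.
  have [g bg] := far (- b^-1 *: w).
  apply/negP; rewrite -leNgt ler_norml (ltW (lt_d g bg)) andbT lerNl opprB.
  have bNg : dual_ball (fun x => -1 * g x).
    split=> [|y]; last by rewrite mulN1r normrN; exact: bg.2.
    by apply/linear_scalarP => c y z; move: bg.1 => /linear_scalarP ->; ring.
  have := lt_d _ bNg; rewrite bidualZ//; last exact: dual_ball_dual.
  by move=> ?; lra.
Qed.

End Nonreflexive.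

(** The evaluation map is isometric, since every vector is normed by a
    functional; so points whose evaluations tend to [phi] form a Cauchy
    sequence. *)
Lemma bidual_eval_closed (R : realType) (E : completeNormedModType R)
    (phi : (E -> R) -> R) :
  bidual phi ->
  (forall d : R, 0 < d -> exists z, forall g, dual_ball g -> `|phi g - g z| <= d) ->
  exists z, forall f, topological_dual f -> phi f = f z.
Proof.
move=> hphi near_phi.
have [d d0 d_small] : exists2 d : nat -> R, forall n, 0 < d n &
    forall e : R, 0 < e -> exists N, forall n, (N <= n)%N -> d n < e.
  exists (fun n => n.+1%:R^-1) => [n|e e0]; first by rewrite invr_gt0.
  by have [N _ hN] := near_infty_natSinv_lt (PosNum e0); exists N.
have /choice[z hz] : forall n : nat, exists z, forall g, dual_ball g ->
    `|phi g - g z| <= d n by move=> n; exact: near_phi.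
have zC n m : `|z n - z m| <= d n + d m.
  have [g [g1 gE]] := norming_functional (z n - z m).
  have bg : dual_ball g by split => //; exact: linearP.
  rewrite -gE linearB/=; have := hz n g bg; have := hz m g bg.
  rewrite !ler_norml => /andP[h1 h2] /andP[h3 h4]; lra.
have /cvg_ex[/= l zl] : cvg (z @ \oo).
  apply/cauchy_cvgP/cauchy_exP => e e0.
  have [|N hN] := d_small (e / 2); first by rewrite divr_gt0.
  exists (z N); exists N => // m /= Nm.
  rewrite -ball_normE/=; apply: le_lt_trans (zC _ _) _.
  have := hN N (leqnn N); have := hN m Nm => *; lra.
exists l.
have ball_l g : dual_ball g -> phi g = g l.
  move=> bg; apply/eqP; rewrite -subr_eq0 -normr_le0; apply/ler_addgt0Pl => e e0.
  rewrite addr0.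
  have e20 : 0 < e / 2 by rewrite divr_gt0.
  have [N1 hN1] := d_small _ e20.
  have [N2 _ hN2] := (cvgrPdist_lt _ _).1 zl _ e20.
  pose n := maxn N1 N2.
  have := hN1 n (leq_maxl _ _); have := hN2 n (leq_maxr _ _) => /= h1 h2.
  have := hz n g bg; have := bg.2 (l - z n).
  have [/linear_bundle[k ->] _] := bg; rewrite linearB/=.
  have := ler_distD (k (z n)) (phi k) (k l).
  rewrite (distrC (k (z n))) => *; lra.
move=> f df; have [lf [C C0 fC]] := (topological_dualP f).1 df.
have bf : dual_ball (fun x => C^-1 * f x).
  split=> [|x].
    apply/linear_scalarP => c x y; move/linear_scalarP : lf => ->; ring.
  by rewrite normrM gtr0_norm ?invr_gt0// mulrC ler_pdivrMr// mulrC.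
have := ball_l _ bf; rewrite bidualZ// => /mulfI; apply.
by rewrite invr_eq0 gt_eqF.
Qed.

Lemma seq_recursion (T : Type) (P : seq T -> T -> Prop) :
  (forall s, exists t, P s t) ->
  exists u : nat -> T, forall n, P (mkseq u n) (u n).
Proof.
move=> /choice[next nextP]; pose s n := iter n (fun s => rcons s (next s)) [::].
exists (fun n => next (s n)) => n.
suff -> : mkseq (fun n => next (s n)) n = s n by exact: nextP.
by elim: n => // n ih; rewrite mkseqS ih.
Qed.

(** The sequence in James' characterization of nonreflexivity. The margin between
    [theta] and [theta / 2] replaces the exact equalities [g n (x k) = theta] and
    [g n (x k) = 0], which leaves room for approximate constructions. *)
Definition staircase (R : realType) (E : normedModType R) (theta : R)
    (x : nat -> E) (g : nat -> E -> R) : Prop :=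
  [/\ forall n, dual_ball (g n),
      forall n k, (n <= k)%N -> theta <= g n (x k) &
      forall n k, (k < n)%N -> g n (x k) <= theta / 2].

(** Choose in turn [g n] almost annihilating [x 0, ..., x (n - 1)] with [phi (g n)]
    close to [d], and [x n] at which [g 0, ..., g n] take almost the same values
    as [phi]. Errors of [d / 4] give [theta = d / 2]; the bound [M] on the
    [x n] is then rescaled to [r]. *)
Lemma nonreflexive_staircase (R : realType) (E : completeNormedModType R) (r : R) :
  0 < r -> ~ reflexive_space E -> exists (theta : R) x (g : nat -> E -> R),
    [/\ 0 < theta, forall n, `|x n| <= r & staircase theta x g].
Proof.
move=> r0 /existsNP[phi /not_implyP[hphi phi_nev]].
have [d d0 far] : exists2 d : R, 0 < d &
    forall z, exists2 g, dual_ball g & d < `|phi g - g z|.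
  apply: contrapT => near_phi; apply: phi_nev; apply: bidual_eval_closed => //.
  move=> d d0; apply: contrapT => no_z; apply: near_phi; exists d => // z.
  apply: contrapT => no_g; apply: no_z; exists z => g bg.
  by rewrite leNgt; apply/negP => ?; apply: no_g; exists g.
have [M M0 hM] := bidual_bounded hphi.
pose T := (E * {g : E -> R | dual_ball g})%type.
pose t0 : T := (0, exist _ _ (@dual_ball0 R E)).
have d40 : 0 < d / 4 by rewrite divr_gt0.
pose P (s : seq T) (t : T) := [/\ `|t.1| <= M,
  `|phi (sval t.2) - d| <= d / 4,
  `|sval t.2 t.1 - phi (sval t.2)| <= d / 4 &
  forall i, (i < size s)%N -> `|sval t.2 (nth t0 s i).1| <= d / 4 /\
    `|sval (nth t0 s i).2 t.1 - phi (sval (nth t0 s i).2)| <= d / 4].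
have [|u uP] := @seq_recursion T P.
  move=> s.
  have [g [bg gd gs]] := dual_approx_annihilator hphi hM
    (fun i : 'I_(size s) => (nth t0 s i).1) far d0 d40.
  pose f (i : option 'I_(size s)) : E -> R :=
    if i is Some j then sval (nth t0 s j).2 else g.
  have bf i : dual_ball (f i) by case: i => //= j; exact: svalP.
  have [x xM fx] := bidual_approx_eval hphi hM M0 bf d40.
  exists (x, exist _ g bg); split => //=; first exact: (fx None).
  move=> i si; split; first exact: (gs (Ordinal si)).
  exact: (fx (Some (Ordinal si))).
have rM0 : 0 < r / M by rewrite divr_gt0.
exists (r / M * (d / 2)), (fun n => (r / M) *: (u n).1), (fun n => sval (u n).2).
have gZ n y : sval (u n).2 ((r / M) *: y) = r / M * sval (u n).2 y.
  by have [/linear_bundle[k ->] _] := svalP (u n).2; exact: linearZ.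
have uPlt n k : (n < k)%N -> `|sval (u k).2 (u n).1| <= d / 4 /\
    `|sval (u n).2 (u k).1 - phi (sval (u n).2)| <= d / 4.
  move=> nk; have [_ _ _] := uP k; rewrite size_mkseq => /(_ n nk).
  by rewrite nth_mkseq.
split; first by rewrite mulr_gt0// divr_gt0.
  move=> n; rewrite normrZ gtr0_norm// mulrAC ler_pdivrMr// ler_pM2l//.
  by have [] := uP n.
split=> [n|n k nk|n k kn]; first exact: svalP.
- rewrite gZ ler_pM2l//; have [_ pd e _] := uP n.
  have : `|sval (u n).2 (u k).1 - phi (sval (u n).2)| <= d / 4.
    move: nk; rewrite leq_eqVlt => /predU1P[<-//|nk].
    by have [] := uPlt n k nk.
  by move: pd; rewrite !ler_norml => /andP[? ?] /andP[? ?]; lra.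
- rewrite gZ -[leRHS]mulrA ler_pM2l//; have [] := uPlt k n kn.
  by rewrite ler_norml => /andP[? ?] _; lra.
Qed.

(** * Coarse quotient maps *)

Section UniformQuotient.
Variables (R : realType) (X Y : normedModType R) (f : X -> Y).
Variables (w W : R).
Hypothesis f_open : forall x y, `|f x - y| <= w ->
  exists2 x', `|x - x'| <= 1 & f x' = y.
Hypothesis f_bounded : forall x x', `|x - x'| <= 1 -> `|f x - f x'| <= W.

Lemma lift_multiple (K : nat) (x : X) (y : Y) : `|y| <= w ->
  exists2 x', `|x - x'| <= K%:R & f x' = f x + K%:R *: y.
Proof.
move=> yw; elim: K => [|K [x' xx' fx']].
  by exists x; rewrite ?subrr ?normr0// scale0r addr0.
have [|x2 x'x2 fx2] := @f_open x' (f x' + y).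
  by rewrite opprD addNKr normrN.
exists x2; last by rewrite fx2 fx' -addrA -natr1 scalerDl scale1r.
by apply: le_trans (ler_distD x' _ _) _; rewrite -natr1 lerD.
Qed.

(** Subdivide the segment from [x] to [x'] into steps of length at most [1]. *)
Lemma coarse_lipschitz (x x' : X) : `|f x - f x'| <= W * (`|x - x'| + 1).
Proof.
have steps (n : nat) : forall x, `|x - x'| <= n%:R -> `|f x - f x'| <= n%:R * W.
  elim: n => [|n ih] {}x.
    by rewrite normr_le0 subr_eq0 => /eqP ->; rewrite subrr normr0 mul0r.
  move=> xn; have n0 : 0 < n.+1%:R :> R by [].
  pose z := x - n.+1%:R^-1 *: (x - x').
  have xz : `|x - z| <= 1.
    rewrite opprB addrC subrK normrZ gtr0_norm ?invr_gt0//.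
    by rewrite mulrC ler_pdivrMr// mul1r.
  have zx' : `|z - x'| <= n%:R.
    have -> : z - x' = (n%:R / n.+1%:R) *: (x - x').
      rewrite /z addrAC -{1}[x - x']scale1r -scalerBl; congr (_ *: _).
      by rewrite -[n%:R](addrK 1) natr1 mulrBl mul1r divff ?gt_eqF.
    rewrite normrZ ger0_norm ?divr_ge0// mulrAC ler_pdivrMr//.
    by rewrite ler_wpM2l.
  apply: le_trans (ler_distD (f z) _ _) _.
  by rewrite -natr1 mulrDl mul1r addrC lerD ?ih ?f_bounded.
have W0 : 0 <= W.
  by apply: le_trans (@f_bounded x x _); rewrite ?subrr ?normr0.
have /andP[nle nlt] := Num.Theory.truncn_itv (normr_ge0 (x - x')).
apply: le_trans (steps (Num.truncn `|x - x'|).+1 _ (ltW nlt)) _.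
by rewrite mulrC ler_wpM2l// -natr1 lerD2r.
Qed.

End UniformQuotient.

(** * The fork argument *)

Section Fork.
Variables (R : realType) (X Y : normedModType R) (f : X -> Y) (N : X -> R).
Variables (theta : R) (x_ : nat -> Y) (g : nat -> Y -> R).
Hypothesis stair : staircase theta x_ g.

(** What the functionals [g i] see of a sum of [s] terms [x_ j], repetitions
    allowed, with [m <= j < n]. *)
Definition block (m n : nat) (s : R) (z : Y) : Prop :=
  (forall i, (i <= m)%N -> theta * s <= g i z) /\
  (forall i, (n <= i)%N -> g i z <= theta / 2 * s).

Lemma stairD n y z : g n (y + z) = g n y + g n z.
Proof.
by case: stair => gb _ _; have [/linear_bundle[k ->] _] := gb n; exact: linearD.
Qed.

Lemma stairB n y z : g n (y - z) = g n y - g n z.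
Proof.
by case: stair => gb _ _; have [/linear_bundle[k ->] _] := gb n; exact: linearB.
Qed.

Lemma block_multiple m (K : nat) : block m m.+1 K%:R (K%:R *: x_ m).
Proof.
have gZ n (a : R) y : g n (a *: y) = a * g n y.
  by case: stair => gb _ _; have [/linear_bundle[k ->] _] := gb n; exact: linearZ.
case: stair => _ up low.
split=> i im; rewrite gZ.
  by rewrite mulrC ler_wpM2l// up.
by rewrite [leRHS]mulrC ler_wpM2l// low.
Qed.

Lemma blockD m1 n1 m2 n2 s1 s2 z1 z2 :
  (m1 <= m2)%N -> (n1 <= n2)%N ->
  block m1 n1 s1 z1 -> block m2 n2 s2 z2 ->
  block m1 n2 (s1 + s2) (z1 + z2).
Proof.
move=> mm nn [up1 low1] [up2 low2]; split=> i ii; rewrite stairD mulrDr lerD//.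
- exact: up1.
- by apply: up2; exact: leq_trans mm.
- by apply: low1; exact: leq_trans ii.
- exact: low2.
Qed.

Lemma norm_block m n s z : block m n s z -> theta * s <= `|z|.
Proof.
move=> [up _]; apply: le_trans (up 0%N _) _ => //.
by case: stair => gb _ _; apply: le_trans (ler_norm _) ((gb 0%N).2 z).
Qed.

Lemma norm_blockB m1 n1 m2 n2 s z1 z2 : (n1 <= m2)%N ->
  block m1 n1 s z1 -> block m2 n2 s z2 -> theta / 2 * s <= `|z2 - z1|.
Proof.
move=> nm [_ low] [up _]; case: (stair) => gb _ _.
apply: le_trans (le_trans (ler_norm _) ((gb m2).2 _)).
by rewrite stairB; have := low _ nm; have := up _ (leqnn m2) => *; lra.
Qed.

(** From every point, some block of size [s] starting arbitrarily far lifts to a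
    move of [N]-length at most [l]. *)
Definition block_reach (s l : R) : Prop := forall (u : X) (m : nat),
  exists (n : nat) (z : Y) (u' : X),
    [/\ (m <= n)%N, block m n s z, f u' = f u + z & N (u - u') <= l].

Hypothesis hN : is_norm N.

(** The fork has centre [v], handle [u] and tips [y j]: the tips come from
    successive blocks, hence are [t * l]-separated, and property (beta) at scale
    [l] moves one of them to within [2 * q * l] of [u]. *)
Lemma block_reach_double (s l t q : R) :
  block_reach s l -> 0 < l ->
  (forall u v, theta / 2 * s <= `|f u - f v| -> t * l <= N (u - v)) ->
  (forall (x : X) (y : nat -> X), N x <= 1 -> (forall n, N (y n) <= 1) ->
    t <= sep N y -> exists n, N (x - y n) / 2 <= q) ->
  block_reach (2 * s) (2 * q * l).
Proof.
case: hN => _ NZ _ rch l0 f_sep fork u m.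
have NZl x : N (l^-1 *: x) = N x / l.
  by rewrite NZ gtr0_norm ?invr_gt0// mulrC.
have NC x y : N (x - y) = N (y - x).
  by rewrite -opprB -scaleN1r NZ normrN1 mul1r.
have [n0 [z0 [v [mn0 b0 fv uv]]]] := rch u m.
have /choice[F hF] : forall k, exists t : nat * Y * X,
    [/\ (k <= t.1.1)%N, block k t.1.1 s t.1.2, f t.2 = f v + t.1.2 &
        N (v - t.2) <= l].
  by move=> k; have [n [z [u' h]]] := rch v k; exists (n, z, u').
pose k_ := fix k_ j := if j is j'.+1 then (F (k_ j')).1.1 else n0.
have k_mono i j : (i <= j)%N -> (k_ i <= k_ j)%N.
  move=> /subnKC <-; elim: (j - i)%N => [|e ih]; first by rewrite addn0.
  rewrite addnS; apply: leq_trans ih _ => /=.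
  by have [] := hF (k_ (i + e)).
pose y j := (F (k_ j)).2.
have y_far i j : (i < j)%N -> t * l <= N (y j - y i).
  move=> ij; apply: f_sep; rewrite /y.
  have [_ bi -> _] := hF (k_ i); have [_ bj -> _] := hF (k_ j).
  have -> (a b c : Y) : a + b - (a + c) = b - c.
    by rewrite opprD addrACA subrr add0r.
  by apply: norm_blockB bi bj; exact: (k_mono i.+1 j).
have [|n||n] := fork (l^-1 *: (u - v)) (fun j => l^-1 *: (y j - v)).
- by rewrite NZl ler_pdivrMr// mul1r.
- by rewrite NZl ler_pdivrMr// mul1r NC; have [] := hF (k_ n).
- apply: lb_le_inf.
    by exists (N (l^-1 *: (y 0%N - v) - l^-1 *: (y 1%N - v))), 0%N, 1%N.
  move=> _ [i [j [/eqP ij ->]]]; rewrite -scalerBr opprB addrA subrK.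
  rewrite NZl ler_pdivlMr//.
  by move: ij; rewrite neq_ltn => /orP[ij|ji]; [rewrite NC|]; exact: y_far.
- rewrite -scalerBr opprB addrA subrK NZl => uy.
  have [kn bn fn _] := hF (k_ n).
  have n0k : (n0 <= k_ n)%N by exact: (k_mono 0%N).
  exists (F (k_ n)).1.1, (z0 + (F (k_ n)).1.2), (y n); split.
  + exact: leq_trans mn0 (leq_trans n0k kn).
  + rewrite mulrDl mul1r; apply: blockD b0 bn; first exact: leq_trans n0k.
    exact: leq_trans kn.
  + by rewrite fn fv addrA.
  + move: uy; rewrite ler_pdivrMr// ler_pdivrMr// => h; lra.
Qed.

End Fork.

(** Lifts of blocks of size [2 ^ k * K] have length at least [t] times
    [C * 2 ^ k * K] by the coarse Lipschitz bound, and at most [q ^ k] times it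
    by iterating the fork argument; hence [t <= q ^ k] for all [k]. *)
Lemma coarse_quotient_reflexive (R : realType) (X : normedModType R)
    (Y : completeNormedModType R) (f : X -> Y) (N : X -> R) (w W : R) :
  0 < w -> 0 < W ->
  (forall x y, `|f x - y| <= w -> exists2 x', `|x - x'| <= 1 & f x' = y) ->
  (forall x x', `|x - x'| <= 1 -> `|f x - f x'| <= W) ->
  equivalent_norm N -> property_beta N -> reflexive_space Y.
Proof.
move=> w0 W0 f_open f_bounded [hN [c [C [c0 C0 cNC]]]] [a [a1 a2 beta]].
apply: contrapT => /(nonreflexive_staircase w0)[theta [x_ [g [theta0 xw stair]]]].
pose t := Num.min 1 (c * theta / (4 * W * C)).
have t0 : 0 < t by rewrite lt_min ltr01/= divr_gt0// !mulr_gt0.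
have [|delta [delta0 fork]] := beta t t0.
  by apply: le_trans a1; rewrite ge_min lexx.
(* Property (beta) may hold with [delta >= 1]; the maximum keeps [q > 0]. *)
pose q := Num.max (2^-1) (1 - delta).
have q0 : 0 < q by rewrite lt_max invr_gt0 ltr0n.
have q1 : q < 1 by rewrite gt_max; apply/andP; split; lra.
(* Blocks of size at least [K] are so large that the additive constant in the
   coarse Lipschitz bound is absorbed. *)
pose K := (Num.truncn (4 * W / theta)).+1.
have hK : 4 * W / theta <= K%:R.
  have : 0 <= 4 * W / theta by rewrite divr_ge0// ?ltW// mulr_gt0.
  by move=> /Num.Theory.truncn_itv/andP[_ /ltW].
have f_sep s l u v : K%:R <= s -> l <= C * s ->
    theta / 2 * s <= `|f u - f v| -> t * l <= N (u - v).
  move=> Ks ls hs.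
  have h1 := le_trans hs (coarse_lipschitz f_bounded u v).
  have h2 : 4 * W <= s * theta by rewrite -ler_pdivrMr//; exact: le_trans hK Ks.
  apply: le_trans (cNC (u - v)).1.
  have h3 : theta / (4 * W) * s <= `|u - v|.
    by rewrite mulrAC ler_pdivrMr ?mulr_gt0//; nra.
  have tl : t * l <= t * (C * s) by rewrite ler_pM2l.
  apply: le_trans tl _.
  have s0 : 0 < s by apply: lt_le_trans Ks; rewrite ltr0n.
  have : t * (C * s) <= c * theta / (4 * W * C) * (C * s).
    by rewrite ler_pM2r ?mulr_gt0// ge_min lexx orbT.
  have -> : c * theta / (4 * W * C) * (C * s) = c * (theta / (4 * W) * s).
    by field; rewrite !gt_eqF.
  by move/le_trans; apply; rewrite ler_pM2l.
have expq k : q ^+ k <= 1 by rewrite exprn_ile1// ltW.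
have K_le k : K%:R <= 2 ^+ k * K%:R :> R.
  by rewrite -[leLHS]mul1r ler_pM2r ?ltr0n// exprn_ege1// ler1n.
have l_le k : C * (2 ^+ k * K%:R) * q ^+ k <= C * (2 ^+ k * K%:R).
  by rewrite ger_pMr// ?mulr_gt0// ?exprn_gt0.
have rch k : block_reach f N theta g (2 ^+ k * K%:R)
    (C * (2 ^+ k * K%:R) * q ^+ k).
  elim: k => [|k ih].
    move=> u m; rewrite expr0 mulr1 mul1r.
    have [u' uu' fu'] := lift_multiple f_open K u (xw m).
    exists m.+1, (K%:R *: x_ m), u'; split=> //; first exact: block_multiple.
    by apply: le_trans (cNC _).2 _; rewrite ler_pM2l.
  have -> : 2 ^+ k.+1 * K%:R = 2 * (2 ^+ k * K%:R) :> R by rewrite exprS mulrA.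
  have -> : C * (2 * (2 ^+ k * K%:R)) * q ^+ k.+1 =
            2 * q * (C * (2 ^+ k * K%:R) * q ^+ k) by rewrite exprS; ring.
  apply: (block_reach_double stair hN ih (t := t)).
  - by rewrite !mulr_gt0 ?exprn_gt0.
  - by move=> u v; apply: f_sep.
  - move=> x y x1 y1 ty; have [n hn] := fork x y x1 y1 ty; exists n.
    by apply: le_trans hn _; rewrite le_max lexx orbT.
have t_le k : t <= q ^+ k.
  have [n [z [u' [_ bz fu' uu']]]] := rch k 0 0%N.
  have s0 : 0 < C * (2 ^+ k * K%:R) by rewrite !mulr_gt0 ?exprn_gt0.
  rewrite -(ler_pM2l s0); apply: le_trans uu'.
  rewrite mulrC; apply: (f_sep (2 ^+ k * K%:R)) => //.
  rewrite fu' opprD addNKr normrN; apply: le_trans (norm_block stair bz).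
  by rewrite ler_pM2r ?mulr_gt0 ?exprn_gt0//; lra.
have : q ^+ k @[k --> \oo] --> (0 : R) by apply: cvg_expr; rewrite gtr0_norm.
move=> /cvgrPdist_lt/(_ t t0)[n _ /(_ n (leqnn n))]/=.
by rewrite sub0r normrN gtr0_norm ?exprn_gt0// ltNge t_le.
Qed.

Theorem theorem3p0p2 (R : realType) (X Y : completeNormedModType R)
  (hXY : uniform_quotient Y X)
  (hbeta : exists N : X -> R, equivalent_norm N /\ property_beta N) :
  reflexive_space Y.
Proof.
have [f [_ [w [W [_ _ w_gt0 _ fwW]]]]] := hXY.
have [N [eN bN]] := hbeta.
have W1 : 0 <= W 1.
  have [_ /(_ (f 0))] := fwW 0 1 ltr01.
  rewrite /closed_ball_/= subrr normr0; apply.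
  by exists 0; rewrite ?subrr ?normr0.
(* The coarse argument needs a positive constant, and [W 1] may vanish. *)
apply: (@coarse_quotient_reflexive R X Y f N (w 1) (W 1 + 1)) => //.
- exact: w_gt0.
- by rewrite ltr_wpDl.
- by move=> x y /(fwW x 1 ltr01).1[x' xx' <-]; exists x'.
- move=> x x' xx'; have [_ /(_ (f x'))] := fwW x 1 ltr01.
  rewrite /closed_ball_/= => h.
  by apply: le_trans (h _) _; [exists x'|rewrite lerDl].
Qed.
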